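(* Let $X$ be a complete metric space with a conical bicombing. Then $X$ also admits a reversible conical bicombing.
   Context: Let $(X,d)$ be a metric space. A (geodesic) bicombing on $X$ is a map $\sigma\colon X\times X\times[0,1]\to X$ such that, writing $\sigma_{pq}(t):=\sigma(p,q,t)$, for all $p,q\in X$ one has $\sigma_{pq}(0)=p$, $\sigma_{pq}(1)=q$, and $d(\sigma_{pq}(t),\sigma_{pq}(s))=|t-s|\cdot d(p,q)$ for all $s,t\in[0,1]$. The bicombing $\sigma$ is conical if $d(\sigma_{pq}(t),\sigma_{p'q'}(t))\le(1-t)\,d(p,p')+t\,d(q,q')$ for all $p,q,p',q'\in X$ and $t\in[0,1]$. It is reversible if $\sigma_{pq}(t)=\sigma_{qp}(1-t)$ for all $p,q\in X$ and all $t\in[0,1]$. *)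

(* Defs.v *)
From HB Require Import structures.
From mathcomp Require Import all_boot all_order all_algebra.
From mathcomp Require Import all_classical all_reals all_analysis.

Set Implicit Arguments.
Unset Strict Implicit.
Unset Printing Implicit Defensive.

Import Order.TTheory GRing.Theory Num.Theory.
Import numFieldNormedType.Exports.

Local Open Scope classical_set_scope.
Local Open Scope ring_scope.

(* The library's completeType is restricted to pointed spaces; this is the
   usual sequential notion, which also makes sense for the empty space. *)
Definition complete_metric (R : realType) (X : metricType R) : Prop :=
  forall u : nat -> X, cauchy (u @ \oo) -> exists l : X, u @ \oo --> l.

(* The time parameter ranges over R, but only values in [0, 1] are ever
   constrained: sigma represents a map X * X * [0, 1] -> X, and its values
   at other times are irrelevant. *)
Definition bicombing (R : realType) (X : metricType R)
    (sigma : X -> X -> R -> X) : Prop :=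
  forall p q : X,
    [/\ sigma p q 0 = p,
        sigma p q 1 = q &
        forall s t : R, 0 <= s <= 1 -> 0 <= t <= 1 ->
          mdist (sigma p q t) (sigma p q s) = `|t - s| * mdist p q].

Definition conical (R : realType) (X : metricType R)
    (sigma : X -> X -> R -> X) : Prop :=
  forall (p q p' q' : X) (t : R), 0 <= t <= 1 ->
    mdist (sigma p q t) (sigma p' q' t) <=
      (1 - t) * mdist p p' + t * mdist q q'.

Definition reversible (R : realType) (X : metricType R)
    (sigma : X -> X -> R -> X) : Prop :=
  forall (p q : X) (t : R), 0 <= t <= 1 ->
    sigma p q t = sigma q p (1 - t).

(* Main.v *)
Require Import Defs.
From mathcomp Require Import all_boot all_order all_algebra.
From mathcomp Require Import all_classical all_reals all_analysis.
From mathcomp Require Import lra.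

(** The heart of the matter is to find a symmetric mean: a map [L] with
    [L x x = x], [L x y = L y x] and
    [d (L x y) (L x' y') <= (d x x' + d y y') / 2].  Averaging a bicombing
    [sigma] with its reversal, as [tau p q t = L (sigma p q t)
    (sigma q p (1 - t))], then gives a reversible map; it is conical because
    both curves are, and a unit-time curve from [p] to [q] that is
    [d p q]-Lipschitz is automatically a constant-speed geodesic.

    The map [m x y = sigma x y (1/2)] has all these properties except symmetry.
    The cure is to iterate [(x, y) |-> (m x y, m y x)].  One step at least
    halves the distance of the two components: [m x y] is at distance at most
    the average of [d x w] and [d y w] from [w], and for [w = m y x] both of
    these are at most [d x y / 2].  Since later iterates moreover stay in every closed ball
    that contains the current pair, both components are Cauchy; completeness
    yields a common limit [L x y], and exchanging [x] and [y] only exchanges the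
    two components.  The Lipschitz estimate for [m] is stable under iteration,
    hence passes to [L]. *)

Set Implicit Arguments.
Unset Strict Implicit.
Unset Printing Implicit Defensive.

Import Order.TTheory GRing.Theory Num.Theory.
Import numFieldNormedType.Exports.

Local Open Scope classical_set_scope.
Local Open Scope ring_scope.

Definition conical_mean (R : realType) (X : metricType R) (m : X -> X -> X) :=
  (forall x, m x x = x) /\
  (forall x y x' y',
     mdist (m x y) (m x' y') <= (mdist x x' + mdist y y') / 2).

Lemma near_geometric_le (R : realType) (c e : R) : 0 < e ->
  \forall n \near \oo, c * 2^-1 ^+ n <= e.
Proof.
move=> e0; have h : `|2^-1 : R| < 1 by rewrite ger0_norm; lra.
by have /cvgr_le/(_ _ e0) := cvg_geometric c h.
Qed.

Lemma mdist_lim_le (R : realType) (X : metricType R) (u v : nat -> X)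
    (l l' : X) (c : R) :
  u @ \oo --> l -> v @ \oo --> l' ->
  (\forall n \near \oo, mdist (u n) (v n) <= c) -> mdist l l' <= c.
Proof.
move=> ul vl' uv; apply/ler_addgt0Pr => e e0.
have e2 : 0 < e / 2 by rewrite divr_gt0.
have hu := cvg_ball ul e2; have hv := cvg_ball vl' e2.
near \oo => n.
have : ball l (e / 2) (u n) by near: n; exact: hu.
have : ball l' (e / 2) (v n) by near: n; exact: hv.
rewrite !ballEmdist /= => hv' hu'.
have : mdist (u n) (v n) <= c by near: n; exact: uv.
have := metric_triangle l (u n) l'; have := metric_triangle (u n) (v n) l'.
rewrite (metric_sym (v n)); lra.
Unshelve. all: by end_near. Qed.

(** The first component of the [n]-th iterate of [(x, y) |-> (m x y, m y x)];
    the second one is [balance m n y x]. *)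
Fixpoint balance (X : Type) (m : X -> X -> X) (n : nat) (x y : X) : X :=
  if n is k.+1 then m (balance m k x y) (balance m k y x) else x.

Lemma balanceD (X : Type) (m : X -> X -> X) n k x y :
  balance m (n + k) x y = balance m n (balance m k x y) (balance m k y x).
Proof. by elim: n x y => [|n IH] x y //=; rewrite !IH. Qed.

Section Balance.
Variables (R : realType) (X : metricType R) (m : X -> X -> X).
Hypothesis mP : conical_mean m.

Lemma balancexx n x : balance m n x x = x.
Proof. by case: mP => mxx _; elim: n => //= n ->. Qed.

Lemma mdist_mean_le w x y : mdist (m x y) w <= (mdist x w + mdist y w) / 2.
Proof. by case: mP => mxx mL; rewrite -{1}(mxx w). Qed.

(** This contraction is what makes the iteration converge.  Comparing the two
    pairs [(x, y)] and [(y, x)] directly would only give the bound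
    [mdist x y]; the factor [1/2] comes from using the average bound twice. *)
Lemma mdist_mean_swap x y : mdist (m x y) (m y x) <= mdist x y / 2.
Proof.
have := mdist_mean_le (m y x) x y.
rewrite (metric_sym x) (metric_sym y).
have := mdist_mean_le x y x; have := mdist_mean_le y y x.
rewrite !mdistxx (metric_sym y); lra.
Qed.

Lemma mdist_balance_swap n x y :
  mdist (balance m n x y) (balance m n y x) <= mdist x y * 2^-1 ^+ n.
Proof.
elim: n => [|n IH] /=; first by rewrite mulr1.
by have := mdist_mean_swap (balance m n x y) (balance m n y x);
  rewrite exprS; lra.
Qed.

Lemma mdist_balance_le n x y w r :
  mdist x w <= r -> mdist y w <= r -> mdist (balance m n x y) w <= r.
Proof.
elim: n x y => [|n IH] x y xw yw //=.
have := mdist_mean_le w (balance m n x y) (balance m n y x).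
have := IH _ _ xw yw; have := IH _ _ yw xw; lra.
Qed.

(** Restarting the iteration at time [k], the [k]-th iterate is within the
    current gap of both components, so all later iterates are too. *)
Lemma mdist_balance_shift n k x y :
  mdist (balance m (n + k) x y) (balance m k x y) <= mdist x y * 2^-1 ^+ k.
Proof.
rewrite balanceD; apply: mdist_balance_le.
  by rewrite mdistxx mulr_ge0 ?mdist_ge0 ?exprn_ge0.
by rewrite metric_sym; exact: mdist_balance_swap.
Qed.

Lemma cauchy_balance x y : cauchy (balance m n x y @[n --> \oo]).
Proof.
apply: cauchy_exP => e e0.
have e2 : 0 < e / 2 by rewrite divr_gt0.
have [k _ /(_ k (leqnn k)) /= hk] := near_geometric_le (mdist x y) e2.
exists (balance m k x y); exists k => // n /= kn.
rewrite ballEmdist /= metric_sym -(subnK kn).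
have := mdist_balance_shift (n - k) k x y; lra.
Qed.

(** The bound fails for [n = 0], where the left-hand side is [mdist x x']. *)
Lemma balance_lipschitz n x y x' y' :
  mdist (balance m n.+1 x y) (balance m n.+1 x' y') <=
    (mdist x x' + mdist y y') / 2.
Proof.
case: mP => _ mL; elim: n x y x' y' => [|n IH] x y x' y'; first exact: mL.
have := mL (balance m n.+1 x y) (balance m n.+1 y x)
           (balance m n.+1 x' y') (balance m n.+1 y' x').
have := IH x y x' y'; have := IH y x y' x'; rewrite /=; lra.
Qed.

Lemma symmetric_conical_mean : complete_metric X ->
  exists2 L : X -> X -> X, conical_mean L & forall x y, L x y = L y x.
Proof.
move=> cX.
have lim (z : X * X) : exists l : X,
    balance m n z.1 z.2 @[n --> \oo] --> l.
  by case: z => x y; apply: cX; exact: cauchy_balance.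
have [L LP] := choice lim.
have d0 (a b : X) : mdist a b <= 0 -> a = b.
  by move=> h; apply: mdist_positivity; apply/le_anti; rewrite h mdist_ge0.
exists (fun x y => L (x, y)); first split.
- move=> x; apply/d0/(mdist_lim_le (LP (x, x)) (cvg_cst x)).
  by apply: nearW => n; rewrite /= balancexx mdistxx.
- move=> x y x' y'; apply: (mdist_lim_le (LP (x, y)) (LP (x', y'))).
  by exists 1%N => // -[|n] // _; exact: balance_lipschitz.
- move=> x y; apply/d0/ler_addgt0Pr => e e0; rewrite add0r.
  apply: (mdist_lim_le (LP (x, y)) (LP (y, x))).
  near=> n; apply: le_trans (mdist_balance_swap n x y) _.
  by near: n; exact: near_geometric_le.
Unshelve. all: by end_near. Qed.

End Balance.

Lemma conical_mean_midpoint (R : realType) (X : metricType R)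
    (sigma : X -> X -> R -> X) : bicombing sigma -> conical sigma ->
  conical_mean (fun x y => sigma x y 2^-1).
Proof.
move=> sB sC; have h01 : 0 <= (2^-1 : R) <= 1 by lra.
split=> [x|x y x' y'].
  case: (sB x x) => s0 _ sL; apply: mdist_positivity.
  rewrite -[X in mdist _ X]s0 sL ?mdistxx ?mulr0 //; lra.
have := sC x y x' y' _ h01; lra.
Qed.

(** If the curve were shorter than its Lipschitz bound between two times, its
    three pieces would be too short to join [c 0] to [c 1]. *)
Lemma lipschitz_geodesic (R : realType) (X : metricType R) (c : R -> X) :
  (forall s t, 0 <= s <= 1 -> 0 <= t <= 1 ->
     mdist (c t) (c s) <= `|t - s| * mdist (c 0) (c 1)) ->
  forall s t, 0 <= s <= 1 -> 0 <= t <= 1 ->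
    mdist (c t) (c s) = `|t - s| * mdist (c 0) (c 1).
Proof.
move=> cL.
have main s t : 0 <= s -> s <= t -> t <= 1 ->
    mdist (c t) (c s) = `|t - s| * mdist (c 0) (c 1).
  move=> s0 st t1; apply/le_anti; rewrite cL ?andTb //=; try lra.
  have := metric_triangle (c 0) (c s) (c 1).
  have := metric_triangle (c s) (c t) (c 1).
  have h1 : mdist (c s) (c 0) <= `|s - 0| * mdist (c 0) (c 1).
    by apply: cL; lra.
  have h2 : mdist (c 1) (c t) <= `|1 - t| * mdist (c 0) (c 1).
    by apply: cL; lra.
  move: h1 h2; rewrite !ger0_norm; try lra.
  rewrite (metric_sym (c s) (c 0)) (metric_sym (c 1)) (metric_sym (c t) (c s)).
  lra.
move=> s t /andP[s0 s1] /andP[t0 t1]; case: (leP s t) => st; first exact: main.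
by rewrite metric_sym distrC; apply: main => //; exact: ltW.
Qed.

Theorem proposition1p3 (R : realType) (X : metricType R) :
  complete_metric X ->
  (exists sigma : X -> X -> R -> X, bicombing sigma /\ conical sigma) ->
  exists tau : X -> X -> R -> X,
    [/\ bicombing tau, conical tau & reversible tau].
Proof.
move=> cX [sigma [sB sC]].
have [L [Lxx LL] Lsym] :=
  symmetric_conical_mean (conical_mean_midpoint sB sC) cX.
exists (fun p q t => L (sigma p q t) (sigma q p (1 - t))); split.
- move=> p q; case: (sB p q) (sB q p) => p0 p1 pL [q0 q1 qL].
  set c := fun t => L (sigma p q t) (sigma q p (1 - t)).
  have c0 : c 0 = p by rewrite /c subr0 p0 q1.
  have c1 : c 1 = q by rewrite /c subrr p1 q0.
  split=> // s t s01 t01.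
  rewrite -/(c t) -/(c s) -[in RHS]c0 -[in RHS]c1.
  apply: lipschitz_geodesic => // {s01 t01}s {}t s01 t01.
  rewrite c0 c1; apply: le_trans (LL _ _ _ _) _.
  rewrite pL // qL; try lra.
  have -> : 1 - t - (1 - s) = s - t by lra.
  rewrite (metric_sym q) (distrC s); lra.
- move=> p q p' q' t t01; apply: le_trans (LL _ _ _ _) _.
  have t01' : 0 <= 1 - t <= 1 by lra.
  have := sC p q p' q' t t01; have := sC q p q' p' (1 - t) t01'; lra.
- by move=> p q t _; rewrite Lsym subKr.
Qed.
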